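(* Let $\nu$ be a Sturmian kneading sequence. Then the co-kneading map satisfies $\widetilde Q(k)\to\infty$ and the turning point $c$ is uniformly recurrent.
   Context: Sturmian kneading sequences. Let $f:[0,1]\to[0,1]$ be a symmetric unimodal map: continuous, strictly increasing on $[0,c]$ and strictly decreasing on $[c,1]$ with $c=\frac12$, $f(\tilde x)=f(x)$ where $\tilde x=1-x$, scaled so that $f(c)=1$; with $c_i=f^i(c)$, assume $c_2<c<c_1$, $c_2<c_3$ and that $f$ has no periodic attractor, is not renormalizable (there is no $n>1$ and interval $J\subset[c_2,c_1]$ containing $c$ with $f^n(J)\subset J$ and $J,\dots,f^{n-1}(J)$ having disjoint interiors) and satisfies the contraction principle (for every $\varepsilon>0$ there is $\delta>0$ with $|f^n(J)|>\delta$ for all $n>0$ and intervals $J$ with $|J|>\varepsilon$). Let $\varphi(x)=f(x)$ for $x\in[0,c]$ and $\varphi(x)=1-f(x)$ for $x\in(c,1]$, let $a<c$ be such that $\varphi(a)=\varphi(1)$, and let $\bar\varphi(x)=\varphi(1)$ for $x\in[0,a]$, $\bar\varphi(x)=\varphi(x)$ otherwise; $\bar\varphi$ is a monotone degree-one circle endomorphism of $[0,1]/(0\sim1)$ and so has a well-defined rotation number. The kneading sequence $\nu=\nu_1\nu_2\cdots$ of $f$ ($\nu_i=1$ if $c_i>c$, $\nu_i=0$ if $c_i<c$) is called Sturmian when this rotation number is irrational (then $(\omega(c),f)$ represents a Sturmian shift). For $n\ge1$, $\mathcal R(n)=\min\{j\ge1:\nu_{n+j}\ne\nu_j\}$. Cutting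 times: $S_0=1$, $S_{k+1}=S_k+\mathcal R(S_k)$. Co-cutting times: $\widetilde S_0=\min\{j>1:\nu_j=1\}$, $\widetilde S_{l+1}=\widetilde S_l+\mathcal R(\widetilde S_l)$. The difference of two consecutive co-cutting times is a cutting time, and $\widetilde Q$ is defined by $S_{\widetilde Q(l)}=\widetilde S_l-\widetilde S_{l-1}$. $c$ is uniformly recurrent if for every open $U\ni c$ there is $M\in\mathbb N$ such that whenever $f^j(c)\in U$, $j\ge0$, then $f^{j+k}(c)\in U$ for some $0<k\le M$; equivalently, every initial block of $\nu$ appears in $\nu$ with bounded gaps. *)

(* Defs.v *)
From mathcomp Require Import all_boot all_order all_algebra.
From mathcomp Require Import all_classical all_reals all_analysis.

Set Implicit Arguments.
Unset Strict Implicit.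
Unset Printing Implicit Defensive.

Import Order.TTheory GRing.Theory Num.Theory.
Import numFieldNormedType.Exports.

Local Open Scope classical_set_scope.
Local Open Scope ring_scope.

(* The interval [0, 1] is a set in a realType R; its self-maps are functions
   R -> R whose values outside [0, 1] are never looked at. *)

Section Dynamics.
Variable R : realType.
Implicit Types (f g F : R -> R) (a p rho : R) (J : set R) (n : nat).

Definition turning : R := 2^-1.

Local Notation c := turning.

Definition crit f n : R := iter n f c.

Record symmetric_unimodal f : Prop := SymmetricUnimodal {
  unimodal_maps : forall x : R, x \in `[0, 1] -> f x \in `[0, 1];
  unimodal_cont : {within `[0, 1], continuous f};
  unimodal_incr : {in `[0, c] &, {homo f : x y / x < y}};
  unimodal_decr : {in `[c, 1] &, {homo f : x y /~ x < y}};
  unimodal_sym : {in `[0, 1], forall x : R, f (1 - x) = f x};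
  unimodal_top : f c = 1
}.

(* A periodic orbit is an attractor when its basin contains a nonempty open
   interval; one-sided attractors are thus included. *)
Definition basin f n p : set R :=
  [set x : R | x \in `[0, 1] /\
     forall e : R, 0 < e -> exists K : nat, forall k, (K <= k)%N ->
       exists2 j : nat, (j < n)%N & `|iter k f x - iter j f p| < e].

Definition periodic_attractor f p n : Prop :=
  [/\ p \in `[0, 1], (0 < n)%N, iter n f p = p &
      exists u v : R, u < v /\ `]u, v[ `<=` basin f n p].

Definition renormalizable f : Prop :=
  exists2 n, (1 < n)%N & exists J,
    [/\ is_interval J, J `<=` `[crit f 2, crit f 1], J c, iter n f @` J `<=` J &
        trivIset [set i | (i < n)%N] (fun i => (iter i f @` J)°)].

(* Length of a nonempty bounded interval; it is 0 on the empty set. *)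
Definition len J : R := sup J - inf J.

Definition contraction_principle f : Prop :=
  forall e : R, 0 < e -> exists2 d : R, 0 < d &
    forall n J, (0 < n)%N -> is_interval J -> J `<=` `[0, 1] ->
      e < len J -> d < len (iter n f @` J).

Record standing_assumptions f : Prop := StandingAssumptions {
  st_unimodal : symmetric_unimodal f;
  st_c2_lt_c : crit f 2 < c;
  st_c_lt_c1 : c < crit f 1;
  st_c2_lt_c3 : crit f 2 < crit f 3;
  st_no_attractor : forall p n, ~ periodic_attractor f p n;
  st_not_renormalizable : ~ renormalizable f;
  st_contraction : contraction_principle f
}.

Definition phi f (x : R) : R := if x <= c then f x else 1 - f x.

Definition phi_bar f a (x : R) : R := if x <= a then phi f 1 else phi f x.

(* Lifts to R of the degree-one circle map that g induces on [0, 1]/(0 ~ 1). *)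
Definition degree_one_lift g F : Prop :=
  [/\ continuous F, forall x, F (x + 1) = F x + 1 &
      {in `[0, 1], forall x : R, exists m : int, F x = g x + m%:~R}].

(* rho represents the rotation number of g, which is a class modulo 1: another
   lift changes rho by an integer, so irrationality of rho depends on g only. *)
Definition is_rotation_number g rho : Prop :=
  exists2 F, degree_one_lift g F &
    forall x, (fun n => iter n F x / n%:R) @ \oo --> rho.

Definition irrational_rotation g : Prop :=
  exists2 rho, is_rotation_number g rho & irrational rho.

(* The value at index 0 is irrelevant. An irrational rotation number of phi_bar
   forces crit f i != c for i > 0, so no case is left out. *)
Definition kneading f : nat -> bool := fun i => c < crit f i.

Definition uniformly_recurrent f (x : R) : Prop :=
  forall U : set R, open U -> U x ->
    exists M : nat, forall j, U (iter j f x) ->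
      exists2 k : nat, (0 < k <= M)%N & U (iter (j + k) f x).

End Dynamics.

Arguments turning {R}.

Section Cutting.
Implicit Types (P : pred nat) (nu : nat -> bool).

(* Least element of P, with value 0 when P is empty. *)
Definition least P : nat :=
  if pselect (exists n, P n) is left exP then ex_minn exP else 0%N.

Definition recur nu n : nat :=
  least [pred j | (0 < j)%N && (nu (n + j)%N != nu j)].

Definition cutting nu k : nat := iter k (fun s => s + recur nu s)%N 1%N.

Definition cocutting nu l : nat :=
  iter l (fun s => s + recur nu s)%N (least [pred j | (1 < j)%N && nu j]).

(* Meaningful for l > 0. A difference that is not a cutting time gets the
   value 0, so divergence of this map entails that all but finitely many
   differences of successive co-cutting times are cutting times. *)
Definition cokneading nu l : nat :=
  least [pred q | cutting nu q == (cocutting nu l - cocutting nu l.-1)%N].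

End Cutting.

(* Main.v *)
Require Import Defs.
From mathcomp Require Import all_boot all_order all_algebra.
From mathcomp Require Import all_classical all_reals all_analysis.
From mathcomp Require Import zify ring lra.
Import Order.TTheory GRing.Theory Num.Theory.
Import numFieldNormedType.Exports.
Local Open Scope classical_set_scope.
Local Open Scope ring_scope.

(* Raising the right half of [phi_bar] by [1] gives a nondecreasing degree-one
   lift [G]. Its rotation number [rho] being irrational, the points
   [G ^ n c + k] of the orbit of the turning point are ordered like the numbers
   [n rho + k]; hence the itinerary of [c] under [phi] is
   [e_n = ceil (n rho) - ceil ((n - 1) rho)], and [nu_n = e_n xor e_(n-1)].
   Since [1/2 < rho < 1], the cutting times are exactly the [n > 0] with
   [e_n = 1], while the co-cutting times satisfy [e_n = 0] and are generated by
   a greedy algorithm: if [d = ceil (n rho) - n rho], then the next difference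
   is the least [j > 0] for which the fractional part of [j rho] is less than
   [d], and this fractional part is subtracted from [d]. As [d] stays positive,
   no difference occurs infinitely often, so these differences tend to infinity.

   For recurrence, if no point of the orbit lay in [y, c[ modulo 1, the
   intervals [G ^ n y, G ^ n c] would be disjoint modulo 1, whereas the
   contraction principle bounds their lengths below. So every left
   neighbourhood of [c] contains an orbit point modulo 1, and by the ordering
   it is visited whenever [- j rho] is close to [0] from above modulo 1, which
   happens with bounded gaps. *)

(** * First disagreements and Euclidean division in the reals *)

Lemma leastE (P : pred nat) (n : nat) :
  P n -> (forall i, (i < n)%N -> ~~ P i) -> least P = n.
Proof.
move=> Pn Pmin; rewrite /least; case: pselect => [ex|[]]; last by exists n.
case: ex_minnP => m Pm mmin; apply/eqP; rewrite eqn_leq mmin //=.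
by rewrite leqNgt; apply/negP => /Pmin; rewrite Pm.
Qed.

Lemma recurE (nu : nat -> bool) (n j : nat) :
  (0 < j)%N -> nu (n + j)%N != nu j ->
  (forall i, (0 < i < j)%N -> nu (n + i)%N = nu i) -> recur nu n = j.
Proof.
move=> j0 neq eqi; apply: leastE => [|i ij] /=; first by rewrite j0.
by rewrite negb_and; case: ltnP => //= i0; rewrite eqi ?i0 ?eqxx.
Qed.

Lemma euclid_nat {R : archiRealFieldType} (x y : R) : 0 <= x -> 0 < y ->
  exists i : nat, i%:R * y <= x < i.+1%:R * y.
Proof.
move=> x0 y0; exists (Num.truncn (x / y)).
rewrite -ler_pdivlMr // -ltr_pdivrMr // truncn_itv //.
by rewrite divr_ge0 // ltW.
Qed.

(** * Ceilings of the multiples of an irrational number *)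

Section Rotation.
Variables (R : realType) (rho : R).
Hypothesis rho_irr : forall (p : nat) (q : int),
  (0 < p)%N -> p%:R * rho != q%:~R.

Definition mult_ceil (n : nat) : int := Num.ceil (n%:R * rho).

(** For [n > 0], [1 - defect n] is the fractional part of [n * rho]. *)
Definition defect (n : nat) : R := (mult_ceil n)%:~R - n%:R * rho.

Lemma mult_ceil0 : mult_ceil 0 = 0.
Proof. by rewrite /mult_ceil mul0r ceil0. Qed.

Lemma defect_itv (n : nat) : (0 < n)%N -> 0 < defect n < 1.
Proof.
move=> n0; rewrite /defect subr_gt0 lt_neqAle rho_irr // /mult_ceil ceil_ge /=.
have := ceilB1_lt (n%:R * rho); rewrite intrD mulrNz; lra.
Qed.

Lemma mult_ceilD (m n : nat) : mult_ceil (m + n) <= mult_ceil m + mult_ceil n.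
Proof.
rewrite /mult_ceil ceil_le_int intrD natrD mulrDl.
by apply: lerD; exact: ceil_ge.
Qed.

(* Pigeonhole gives a multiple of [rho] close to an integer; if it lies on the
   wrong side, enough copies of it are added to [rho]. *)
Lemma dirichlet (d : R) : 0 < d ->
  exists p (q : int), (0 < p)%N /\ 0 < p%:R * rho - q%:~R < d.
Proof.
move=> d0.
pose N := (Num.truncn d^-1).+1.
have N0 : (0 : R) < N%:R by rewrite ltr0n.
have Nd : N%:R^-1 < d.
  by rewrite -[d]invrK ltf_pV2 ?posrE ?invr_gt0 //; exact: truncnS_gt.
have close : exists p (q : int), (0 < p)%N /\ `|p%:R * rho - q%:~R| < d.
  (* Two of these [N + 1] defects share one of [N] boxes of length [1 / N < d]. *)
  pose g (i : 'I_N.+1) : 'I_N := inord (Num.truncn (N%:R * defect i.+1)).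
  have gP i : (nat_of_ord (g i))%:R <= N%:R * defect i.+1 < (g i)%:R + 1.
    have /andP[t0 t1] := defect_itv i.+1 isT.
    have h0 : 0 <= N%:R * defect i.+1 by rewrite mulr_ge0 ?ltW.
    by rewrite natr1 inordK ?truncn_itv // truncn_lt_nat // gtr_pMr.
  have : ~~ injectiveb g.
    apply/injectiveP => /leq_card; by rewrite !card_ord ltnn.
  case/injectivePn => i [j ij gij].
  wlog lij : i j ij gij / (i < j)%N.
    move=> H; case: (ltngtP i j) => [|lji|/val_inj e]; first exact: H.
      by apply: (H j i) => //; rewrite eq_sym.
    by rewrite e eqxx in ij.
  exists (j - i)%N, (mult_ceil j.+1 - mult_ceil i.+1).
  split; first by rewrite subn_gt0.
  apply: lt_trans Nd; rewrite natrB 1?ltnW // -[_^-1]mul1r ltr_pdivlMr //.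
  have := gP i; have := gP j; rewrite gij /defect intrD mulrNz.
  rewrite -natr1 -[i.+1%:R]natr1 => /andP[h1 h2] /andP[h3 h4].
  rewrite -(ger0_norm (ltW N0)) -normrM ltr_norml.
  apply/andP; split; lra.
have [p [q [p0]]] := close.
have := rho_irr p q p0; rewrite -subr_eq0; case: (ltrgt0P (p%:R * rho - q%:~R)).
- by move=> h _ h'; exists p, q; rewrite h.
- move=> h _; set g := - _ => gd.
  have g0 : 0 < g by rewrite oppr_gt0.
  have /andP[f0 f1] := floor_itv rho.
  have : 0 <= rho - (Num.floor rho)%:~R by lra.
  (* Removing [g] from the fractional part of [rho] as often as possible leaves less than [g < d],
     and not [0] by irrationality. *)
  move=> /euclid_nat /(_ g0)[i /andP[i1 i2]].
  exists (1 + i * p)%N, (Num.floor rho + i%:Z * q); split=> //.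
  have neq := rho_irr (1 + i * p)%N (Num.floor rho + i%:Z * q) isT.
  have E : (1 + i * p)%:R * rho - (Num.floor rho + i%:Z * q)%:~R =
      rho - (Num.floor rho)%:~R - i%:R * g.
    rewrite /g natrD natrM intrD intrM -pmulrn; ring.
  rewrite lt_neqAle eq_sym subr_eq0 neq /= E; move: i2; rewrite -natr1; lra.
- by [].
Qed.

Hypotheses (rho_gt : 1 < 2 * rho) (rho_lt : rho < 1).

Lemma mult_ceilS (n : nat) : mult_ceil n <= mult_ceil n.+1 <= mult_ceil n + 1.
Proof.
rewrite /mult_ceil -natr1 mulrDl mul1r !ceil_le_int intrD.
have := ceil_ge (n%:R * rho); have := ceil_ge (n%:R * rho + rho).
move: rho_gt rho_lt => ? ? h1 h2; apply/andP; split; lra.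
Qed.

Lemma mult_ceilSS (n : nat) : mult_ceil n + 1 <= mult_ceil n.+2.
Proof.
rewrite /mult_ceil lezD1 ceil_gt_int.
have := ceilB1_lt (n%:R * rho); rewrite intrD mulrNz -!natr1.
move: rho_gt => ? ?; lra.
Qed.

(* Itinerary of the orbit of [0] under the rotation; the value at [0] matches
   the convention that the turning point belongs to the left half. *)
Definition itinerary (n : nat) : bool :=
  if n is m.+1 then mult_ceil m < mult_ceil n else false.

Lemma mult_ceil1 : mult_ceil 1 = 1.
Proof. by rewrite /mult_ceil mul1r; apply: ceil_def; move: rho_gt rho_lt; lra. Qed.

Lemma itinerary1 : itinerary 1.
Proof. by rewrite /= mult_ceil0 mult_ceil1. Qed.

Lemma itinerary2 : itinerary 2.
Proof. by rewrite /= mult_ceil1 /mult_ceil ceil_gt_int. Qed.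

Lemma itinerary_no00 (n : nat) : itinerary n.+1 || itinerary n.+2.
Proof. have := mult_ceilSS n; rewrite /=; lia. Qed.

(** * Cutting and co-cutting times *)

Variable nu : nat -> bool.
Hypothesis nuE : forall n, nu n.+1 = itinerary n.+1 (+) itinerary n.

Lemma nu1 : nu 1.
Proof. by rewrite nuE itinerary1. Qed.

Lemma nu2 : nu 2 = false.
Proof. by rewrite nuE itinerary1 itinerary2. Qed.

(** Two consecutive digits are never both [0], so the previous digit [1] is one or two places back;
    as [nu] starts with [1 0], the first disagreement from there leads to [n]. *)
Lemma cutting_surj (n : nat) : (0 < n)%N -> itinerary n ->
  exists q, cutting nu q = n.
Proof.
elim/ltn_ind: n => -[//|[|[|n]]] IH _ en; first by exists 0%N.
  exists 1%N; rewrite /cutting /=; suff -> : recur nu 1 = 1%N by [].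
  by apply: recurE => [//||[|i]//]; rewrite nu1 addn1 nu2.
case en2 : (itinerary n.+2).
  have [q qE] := IH n.+2 (ltnSn _) isT en2; exists q.+1.
  rewrite /cutting iterS -/(cutting nu q) qE (_ : recur _ _ = 1%N) ?addn1 //.
  by apply: recurE => [//||[|i]//]; rewrite nu1 addn1 nuE en en2.
have en1 : itinerary n.+1 by have := itinerary_no00 n; rewrite en2 orbF.
have [q qE] := IH n.+1 (leqnSn n.+2) isT en1; exists q.+1.
rewrite /cutting iterS -/(cutting nu q) qE (_ : recur _ _ = 2%N) ?addn2 //.
apply: recurE => [//||[|[|i]]//]; first by rewrite nu2 addn2 nuE en en2.
by rewrite addn1 nuE en1 en2 nu1.
Qed.

Lemma mult_ceilD_itinerary (n j : nat) :
  mult_ceil (n + j) = mult_ceil n + mult_ceil j ->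
  mult_ceil (n + j.+1) = mult_ceil n + mult_ceil j.+1 ->
  itinerary (n + j.+1) = itinerary j.+1.
Proof. by rewrite addnS /= => -> ->; rewrite ltrD2l. Qed.

(* The first disagreement is the first [j] such that the fractional part of
   [j * rho] is below the defect of [n]: passing to the next co-cutting time
   subtracts that fractional part from the defect. *)
Lemma recur_itinerary0 (n : nat) (j := recur nu n) :
  (0 < n)%N -> ~~ itinerary n ->
  [/\ (0 < j)%N, itinerary j, ~~ itinerary (n + j) &
      defect (n + j) = defect n - (1 - defect j)].
Proof.
move=> n0 en.
have [k kP] : exists k, mult_ceil (n + k) < mult_ceil n + mult_ceil k.
  have /andP[d0 _] := defect_itv n n0.
  have [p [q [p0 /andP[pq1 pq2]]]] := dirichlet _ d0.
  exists p; apply: (@le_lt_trans _ _ (mult_ceil n + q)).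
    rewrite /mult_ceil ceil_le_int natrD intrD; move: pq2; rewrite /defect.
    rewrite /mult_ceil; lra.
  by rewrite ltrD2l /mult_ceil ceil_gt_int; lra.
case: (@ex_minnP [pred k | mult_ceil (n + k) < mult_ceil n + mult_ceil k]).
  by exists k.
move=> {k kP} m /= mP mmin.
have eqm i : (i < m)%N -> mult_ceil (n + i) = mult_ceil n + mult_ceil i.
  move=> im; apply/eqP; rewrite eq_le mult_ceilD /= leNgt.
  by apply/negP => /mmin; rewrite leqNgt im.
case: m => [|m] in mP mmin eqm *.
  by rewrite addn0 mult_ceil0 addr0 ltxx in mP.
have eqmm := eqm m (leqnn _).
(* Additivity holds at [m] and fails at [m.+1]. Both increments being [0] or [1], the one at [m] is
   [1] and the one at [n + m] is [0]. *)
have /andP[a1 a2] := mult_ceilS (n + m); have /andP[b1 b2] := mult_ceilS m.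
have em : itinerary m.+1 by move: mP; rewrite addnS /=; lia.
have enm : ~~ itinerary (n + m.+1) by move: mP; rewrite addnS /=; lia.
have eqit i : (i < m.+1)%N -> itinerary (n + i) = itinerary i.
  case: i => [_|i im]; first by rewrite addn0 (negbTE en).
  by apply: mult_ceilD_itinerary; apply: eqm => //; exact: ltnW.
have -> : j = m.+1.
  apply: recurE => //.
    by rewrite addnS !nuE -addnS em (negbTE enm) eqit //; case: itinerary.
  by case=> // i im; rewrite addnS !nuE -addnS !eqit //; exact: ltnW.
split=> //; rewrite /defect.
have -> : mult_ceil (n + m.+1) = mult_ceil n + mult_ceil m.+1 - 1.
  by move: mP; rewrite addnS; lia.
by rewrite !intrD mulrNz natrD; ring.
Qed.

(** All positive digits before the first zero digit are [1], so that place is the first index above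
    [1] where [nu] is [1]. Without zero digits, [mult_ceil k = k] would give [k (1 - rho) < 1] for
    all [k > 0]. *)
Lemma first_cocutting : (0 < cocutting nu 0)%N /\ ~~ itinerary (cocutting nu 0).
Proof.
have [k kP] : exists k, (0 < k)%N && ~~ itinerary k.
  apply/not_existsP => H.
  have e k : itinerary k.+1 by apply/negPn/negP => ek; apply: (H k.+1).
  have eqC k : mult_ceil k = k%:Z.
    elim: k => [|k IH]; first exact: mult_ceil0.
    by have := e k; have := mult_ceilS k; rewrite /= IH; lia.
  have r2 : 0 < 1 - rho by rewrite subr_gt0.
  have [i /andP[_]] := euclid_nat 1 (1 - rho) ler01 r2.
  have := ceilB1_lt (i.+1%:R * rho); rewrite -/(mult_ceil i.+1) eqC.
  rewrite intrD mulrNz -pmulrn; move: rho_lt => ? ? ?; lra.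
case: (@ex_minnP [pred k | (0 < k)%N && ~~ itinerary k]); first by exists k.
move=> {k kP} m /andP[m0 em] mmin.
have em' i : (0 < i < m)%N -> itinerary i.
  move=> /andP[i0 im]; apply/negPn/negP => ei; have := mmin i.
  by rewrite /= i0 ei leqNgt im => /(_ isT).
have -> : cocutting nu 0 = m; last by [].
case: m => [|[|m]] in m0 em mmin em' *; [by []|by move: em; rewrite itinerary1|].
apply: leastE => [|[|[|i]] im] //.
  by rewrite inE nuE (negbTE em) em' /= ?ltnSn.
by rewrite inE nuE (em' i.+2 im) (em' i.+1 (ltnW im)).
Qed.

Lemma cocuttingP (l : nat) :
  (0 < cocutting nu l)%N /\ ~~ itinerary (cocutting nu l).
Proof.
elim: l => [|l [n0 en]]; first exact: first_cocutting.
rewrite /cocutting iterS -/(cocutting nu l).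
by have [j0 _ enj _] := recur_itinerary0 _ n0 en; rewrite addn_gt0 n0.
Qed.

(** The defects along the co-cutting times decrease and stay positive, so their decrements
    [1 - defect j] tend to [0]; those with [j <= B] are bounded below. *)
Lemma recur_cocutting_cvg (B : nat) :
  \forall l \near \oo, (B < recur nu (cocutting nu l))%N.
Proof.
have [d d0 dP] : exists2 d : R, 0 < d &
    forall j, (0 < j <= B)%N -> d <= 1 - defect j.
  elim: B => [|B [d d0 dP]]; first by exists 1 => // -[].
  have := defect_itv B.+1 isT => /andP[_ h].
  exists (Num.min d (1 - defect B.+1)); first by rewrite lt_min d0 subr_gt0.
  move=> j /andP[j0]; rewrite leq_eqVlt => /orP[/eqP ->|jB].
    by rewrite ge_min lexx orbT.
  by rewrite ge_min dP // j0.
pose u l := defect (cocutting nu l).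
have uS l : u l.+1 = u l - (1 - defect (recur nu (cocutting nu l))).
  rewrite /u /cocutting iterS -/(cocutting nu l).
  by have [n0 en] := cocuttingP l; have [] := recur_itinerary0 _ n0 en.
have u_cvg : cvgn u.
  apply: nonincreasing_is_cvgn.
    apply/nonincreasing_seqP => l; rewrite uS.
    have [n0 en] := cocuttingP l; have [j0 _ _ _] := recur_itinerary0 _ n0 en.
    by have /andP[_ h] := defect_itv _ j0; lra.
  exists 0 => _ [l _ <-]; have [n0 _] := cocuttingP l.
  by have /andP[/ltW] := defect_itv _ n0.
have du : (fun l => u l - u l.+1) @ \oo --> (0 : R).
  rewrite -(subrr (limn u)); apply: cvgB => //.
  by rewrite (cvg_shiftS u).
have /cvgrPdist_lt /(_ d d0) := du; apply: filterS => l.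
rewrite sub0r normrN uS => h.
have [n0 en] := cocuttingP l; have [j0 _ _ _] := recur_itinerary0 _ n0 en.
rewrite ltnNge; apply/negP => jB; have := dP _ (introT andP (conj j0 jB)).
by have := ler_norm (u l - (u l - (1 - defect (recur nu (cocutting nu l))))); lra.
Qed.

Lemma cokneading_cvg : cokneading nu @ \oo --> \oo.
Proof.
apply/cvgnyPge => A.
(* A difference exceeding the first [A] cutting times can only have an index at least [A]. *)
have := recur_cocutting_cvg (\max_(q < A) cutting nu q) => -[N _ NP].
exists N.+1 => // -[//|l] /= Nl.
have {NP Nl} /= := NP l Nl.
have [n0 en] := cocuttingP l; have [j0 ej _ _] := recur_itinerary0 _ n0 en.
have [q qE] := cutting_surj _ j0 ej => jmax.
rewrite /cokneading /= {2 3}/cocutting.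
have -> : (cocutting nu l.+1 - cocutting nu l = recur nu (cocutting nu l))%N.
  by rewrite /cocutting iterS addKn.
(* The difference has digit [1], hence is a cutting time, and [least] does not take its default
   value. *)
rewrite /least; case: pselect => [ex|[]]; last by exists q; rewrite /= qE.
case: ex_minnP => m /= /eqP mE _; rewrite leqNgt; apply/negP => mA.
have := leq_bigmax (F := fun q : 'I_A => cutting nu q) (Ordinal mA).
by rewrite /= mE leqNgt jmax.
Qed.

End Rotation.

(** * Rotation number and orbit order of a monotone degree-one lift *)

Section DegreeOne.
Variables (R : realType) (G : R -> R) (rho : R).
Hypothesis G_homo : {homo G : x y / x <= y}.
Hypothesis G_per : forall x, G (x + 1) = G x + 1.
Hypothesis G_rot : forall x, (fun n => iter n G x / n%:R) @ \oo --> rho.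
Hypothesis rho_irr : forall (p : nat) (q : int),
  (0 < p)%N -> p%:R * rho != q%:~R.

Lemma lift_translate (x : R) (k : int) : G (x + k%:~R) = G x + k%:~R.
Proof.
have pos (y : R) (n : nat) : G (y + n%:R) = G y + n%:R.
  elim: n => [|n IH]; first by rewrite !addr0.
  by rewrite -natr1 !addrA G_per IH.
case: k => n; first exact: pos.
by rewrite NegzE mulrNz -pmulrn -[in RHS](subrK n.+1%:R x) pos addrK.
Qed.

Lemma iter_translate (n : nat) (x : R) (k : int) :
  iter n G (x + k%:~R) = iter n G x + k%:~R.
Proof. by elim: n => //= n ->; rewrite lift_translate. Qed.

Lemma iter_homo (n : nat) : {homo iter n G : x y / x <= y}.
Proof. by elim: n => //= n IH x y /IH; exact: G_homo. Qed.

Lemma iter_lt_inv (n : nat) (x y : R) : iter n G x < iter n G y -> x < y.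
Proof. by apply: contraTT; rewrite -!leNgt; exact: iter_homo. Qed.

(** Divide by [k] and let it grow. The signs [s = 1] and [s = -1] give upper and lower bounds for
    the rotation number. *)
Lemma rotation_bound (s x b t : R) (p : nat) : (0 < p)%N ->
  (forall k, s * iter (k * p) G x <= b + k%:R * t) -> s * (p%:R * rho) <= t.
Proof.
move=> p0 bound; rewrite leNgt; apply/negP => h.
have e0 : 0 < (s * (p%:R * rho) - t) / 2 by lra.
set e := _ / 2 in e0.
have : (fun n => s * (p%:R * (iter n G x / n%:R))) @ \oo --> s * (p%:R * rho).
  by apply: cvgMr; apply: cvgMr.
move=> /cvgrPdist_lt /(_ e e0) [N _ NP].
have [k /andP[_ kb]] := euclid_nat `|b| e (normr_ge0 _) e0.
(* [K] is large enough both for the convergence and for [b / K <= e]. *)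
pose K := (maxn N k.+1); have K0 : (0 < K)%N by rewrite /K leq_max orbT.
have := NP (K * p)%N; rewrite /= (leq_trans (leq_maxl N k.+1)) ?leq_pmulr //.
move=> /(_ isT); have := bound K.
have pR : (0 : R) < p%:R by rewrite ltr0n.
have KR : (0 : R) < K%:R by rewrite ltr0n.
set I := iter _ _ _ => bK; rewrite ltr_norml => /andP[_].
have -> : s * (p%:R * (I / (K * p)%:R)) = s * I / K%:R.
  by rewrite natrM; field; rewrite !gt_eqF.
have : s * I / K%:R <= (b + K%:R * t) / K%:R by rewrite ler_pM2r // invr_gt0.
have : (b + K%:R * t) / K%:R <= e + t.
  rewrite ler_pdivrMr //.
  have : k.+1%:R * e <= K%:R * e by rewrite ler_pM2r // ler_nat leq_maxr.
  have := ler_norm b; lra.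
rewrite /e; lra.
Qed.

(** Monotonicity iterates the hypothesis to [G ^ (k p) x <= x + k q]; irrationality makes the limit
    inequality strict. *)
Lemma iter_le_rotation (p : nat) (q : int) (x : R) :
  (0 < p)%N -> iter p G x <= x + q%:~R -> p%:R * rho < q%:~R.
Proof.
move=> p0 h; rewrite lt_neqAle rho_irr //= -[_ * rho]mul1r.
apply: (rotation_bound 1 x x) => // k; rewrite mul1r.
elim: k => [|k IH]; first by rewrite mul0r addr0.
rewrite mulSn iterD; have := iter_homo p _ _ IH => /le_trans; apply.
have -> : k%:R * q%:~R = (k%:Z * q)%:~R :> R by rewrite intrM -pmulrn.
rewrite iter_translate intrM -pmulrn -natr1; lra.
Qed.

Lemma iter_ge_rotation (p : nat) (q : int) (x : R) :
  (0 < p)%N -> x + q%:~R <= iter p G x -> q%:~R < p%:R * rho.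
Proof.
move=> p0 h; rewrite lt_neqAle eq_sym rho_irr //= -lerN2 -[- (_ * _)]mulN1r.
apply: (rotation_bound (-1) x (- x)) => // k; rewrite mulN1r.
elim: k => [|k IH]; first by rewrite mul0r addr0.
rewrite mulSn iterD lerNl.
have : x + (k%:Z * q)%:~R <= iter (k * p) G x.
  by move: IH; rewrite intrM -pmulrn; lra.
move=> /(iter_homo p); apply: le_trans.
by rewrite iter_translate intrM -pmulrn -natr1; lra.
Qed.

Lemma iter_lt_rotation (p : nat) (q : int) (x : R) : (0 < p)%N ->
  (iter p G x < x + q%:~R) = (p%:R * rho < q%:~R).
Proof.
move=> p0; apply/idP/idP => [/ltW/iter_le_rotation -> //|].
by apply: contraTT; rewrite -!leNgt => /iter_ge_rotation/ltW ->.
Qed.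

Lemma iter_gt_rotation (p : nat) (q : int) (x : R) : (0 < p)%N ->
  (x + q%:~R < iter p G x) = (q%:~R < p%:R * rho).
Proof.
move=> p0; apply/idP/idP => [/ltW/iter_ge_rotation -> //|].
by apply: contraTT; rewrite -!leNgt => /iter_le_rotation/ltW ->.
Qed.

(** The later point is an iterate of the earlier one, so its displacement is compared with an
    integer; the rotation number decides this regardless of the base point. *)
Lemma orbit_order (x : R) (m n : nat) (k : int) :
  (iter n G x < iter m G x + k%:~R) = (n%:R * rho < m%:R * rho + k%:~R).
Proof.
case: (ltngtP n m) => [lt_nm|lt_mn|->]; last by rewrite !ltrDl.
- rewrite -(subnK (ltnW lt_nm)) iterD natrD mulrDl -ltrBlDr -mulrNz.
  rewrite iter_gt_rotation ?subn_gt0 // mulrNz.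
  by apply/idP/idP; lra.
- rewrite -(subnK (ltnW lt_mn)) iterD natrD mulrDl.
  by rewrite iter_lt_rotation ?subn_gt0 // addrC ltrD2l.
Qed.

End DegreeOne.

(** * Construction of the normalized lift *)

Lemma int_valued_constant {R : realType} (g : R -> R) (u v : R) :
  {within `[u, v], continuous g} ->
  {in `[u, v], forall x, exists m : int, g x = m%:~R} ->
  {in `[u, v], forall x, g x = g u}.
Proof.
move=> gc gint x /[dup] xin; rewrite in_itv /= => /andP[ux xv].
have [m mE] := gint x xin.
have uin : u \in `[u, v] by rewrite in_itv /= lexx (le_trans ux).
have [n nE] := gint u uin.
apply/eqP; apply: contraT => neq.
(* Two distinct integer values would force the intermediate value [k + 1/2]. *)
pose k := Num.min m n.
have kE : Num.min (g u) (g x) = k%:~R.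
  rewrite mE nE /k; case: (ltP m n) => h.
    by rewrite min_r // ler_int ltW.
  by rewrite min_l // ler_int.
have kE' : (k + 1)%:~R <= Num.max (g u) (g x).
  move: neq; rewrite mE nE eqr_int /k => neq; rewrite le_max !ler_int; lia.
have : Num.min (g u) (g x) <= k%:~R + 2^-1 <= Num.max (g u) (g x).
  by rewrite kE; move: kE'; rewrite intrD => h; apply/andP; split; lra.
have gc' : {within `[u, x], continuous g}.
  apply: continuous_subspaceW gc => y /=; rewrite !in_itv /= => /andP[-> yx].
  exact: le_trans yx xv.
move=> /(IVT ux gc')[z]; rewrite in_itv /= => /andP[uz zx].
have [|l ->] := gint z; first by rewrite in_itv /= uz (le_trans zx).
move=> e.
have h1 : (k%:~R : R) < l%:~R by rewrite e; lra.
have h2 : (l%:~R : R) < (k + 1)%:~R by rewrite e intrD; lra.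
by move: h1 h2; rewrite !ltr_int; lia.
Qed.

Lemma turningE (R : realType) : 2 * turning = 1 :> R.
Proof. by rewrite /turning divff. Qed.

Lemma rational_quotient (R : realType) (x : R) (p : nat) (q : int) :
  irrational x -> (0 < p)%N -> p%:R * x != q%:~R.
Proof.
move=> xirr p0; apply/eqP => e; apply: xirr; exists (q%:~R / p%:R) => //.
rewrite fmorph_div /= ratr_int ratr_nat -e mulrC mulKf //.
by rewrite pnatr_eq0 -lt0n.
Qed.

(* [phi_bar f a] becomes continuous and monotone once its right half is raised
   by [1]. *)
Lemma exists_normalized_lift (R : realType) (f : R -> R) (a : R) :
  symmetric_unimodal f -> 0 <= a < turning ->
  phi f a = phi f 1 -> irrational_rotation (phi_bar f a) ->
  exists G : R -> R, exists rho : R,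
  [/\ [/\ {homo G : x y / x <= y}, forall x, G (x + 1) = G x + 1,
      forall x, 0 <= x <= a -> G x = 1 - f 1,
      forall x, a <= x <= turning -> G x = f x &
      forall x, turning <= x <= 1 -> G x = 2 - f x],
      forall x, (fun n => iter n G x / n%:R) @ \oo --> rho &
      forall (p : nat) (q : int), (0 < p)%N -> p%:R * rho != q%:~R].
Proof.
move=> [fmaps fcont fincr fdecr fsym fc] /andP[a0 ac] phia.
move=> [rho0 [F [Fc Fper Flift]]] Frot rho_irr.
have c1 := turningE R.
have c0 : (0 : R) < turning by lra.
have cl : turning < (1 : R) by lra.
have phi1 : phi f 1 = 1 - f 1 by rewrite /phi leNgt cl.
have fa : f a = 1 - f 1 by move: phia; rewrite phi1 /phi ltW.
(* The given lift [F] is the normalized one plus this integer [m]. *)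
have [m mE] := Flift 0 ltac:(by rewrite in_itv /= lexx ler01).
rewrite /phi_bar a0 phi1 in mE.
have fcW u v : 0 <= u -> v <= 1 -> {within `[u, v], continuous f}.
  move=> u0 v1; apply: continuous_subspaceW fcont => y /=.
  by rewrite !in_itv /= => /andP[uy yv]; rewrite (le_trans u0) // (le_trans yv).
(* The integer-valued difference of [F] and a continuous branch is constant, so each branch is
   settled by the value at its left end, known from the previous branch. *)
have piece (h : R -> R) (u v k : R) : {within `[u, v], continuous h} ->
    (forall y, u <= y <= v -> exists l : int, F y = h y + l%:~R) ->
    F u = h u + k -> forall y, u <= y <= v -> F y = h y + k.
  move=> hc hint Fu y yuv.
  have := @int_valued_constant R (fun x => F x - h x) u v.
  rewrite Fu => /(_ _ _ y yuv) e; apply/eqP; rewrite -subr_eq0.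
  have -> : F y - (h y + k) = F y - h y - (h u + k - h u) by ring.
  rewrite subr_eq0; apply/eqP; apply: e.
  - move=> z; apply: cvgB; last exact: hc.
    exact: continuous_subspaceT.
  - by move=> z; rewrite in_itv /= => /hint[l ->]; exists l; ring.
have flat : forall x, 0 <= x <= a -> F x = 1 - f 1 + m%:~R.
  apply: (piece (fun=> 1 - f 1)) => //; first exact: cst_continuous.
  move=> y /andP[y0 ya]; have [|k ->] := Flift y.
    by rewrite in_itv /=; apply/andP; split; lra.
  by exists k; rewrite /phi_bar ya phi1.
have left : forall x, a <= x <= turning -> F x = f x + m%:~R.
  apply: piece; [by apply: fcW => //; exact: ltW| |].
    move=> y /andP[ay yc]; have [|k ->] := Flift y.
      by rewrite in_itv /=; apply/andP; split; lra.
    exists k; rewrite /phi_bar; case: leP => ya; last by rewrite /phi yc.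
    have -> : y = a by apply/eqP; rewrite eq_le ya.
    by rewrite phi1 fa.
  by rewrite flat ?a0 ?lexx // fa.
have right : forall x, turning <= x <= 1 -> F x = 2 - f x + m%:~R.
  apply: piece.
  - move=> y; apply: cvgB; first exact: cst_continuous.
    by apply: fcW => //; exact: ltW.
  - move=> y /andP[cy y1]; have [|k ->] := Flift y.
      by rewrite in_itv /=; apply/andP; split; lra.
    rewrite /phi_bar leNgt (lt_le_trans ac cy) /= /phi.
    case: leP => yc.
      (* Here [phi] takes its left branch, which agrees with [2 - f] since [f] is [1] there. *)
      have -> : y = turning by apply/eqP; rewrite eq_le yc.
      by exists k; rewrite fc; ring.
    by exists (k - 1); rewrite intrD mulrNz; ring.
  - by rewrite left ?fc ?lexx ?ltW //; ring.
exists (fun x => F x - m%:~R), (rho0 - m%:~R).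
have F01 x y : 0 <= x -> x <= y -> y <= 1 -> F x <= F y.
  have hl u v : a <= u -> u <= v -> v <= turning -> F u <= F v.
    move=> au; rewrite le_eqVlt => /orP[/eqP <- //|uv vc].
    rewrite !left ?lerD2r; try (apply/andP; split; lra).
    by apply/ltW/fincr; rewrite // in_itv /=; apply/andP; split; lra.
  have hr u v : turning <= u -> u <= v -> v <= 1 -> F u <= F v.
    move=> cu; rewrite le_eqVlt => /orP[/eqP <- //|uv v1].
    rewrite !right ?lerD2r ?lerD2l ?lerN2; try (apply/andP; split; lra).
    by apply/ltW/fdecr; rewrite // in_itv /=; apply/andP; split; lra.
  have hf u : 0 <= u <= a -> F u = F a.
    by move=> ua; rewrite !flat // a0 lexx.
  move=> x0 xy y1; case: (leP y a) => [ya|/ltW ay].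
    by rewrite (hf x) ?(hf y) //; apply/andP; split; lra.
  wlog ax : x x0 xy / a <= x.
    move=> H; case: (leP a x) => [|/ltW xa]; first exact: H.
    by rewrite (hf x) ?x0 //; apply: H.
  case: (leP y turning) => [yc|/ltW cy]; first exact: hl.
  case: (leP turning x) => [cx|/ltW xc]; first exact: hr.
  by apply: (le_trans (hl x turning ax xc (lexx _))); exact: hr.
split.
- split.
  + move=> x y xy; rewrite lerD2r.
    have Fz (u : R) (k : int) : F (u + k%:~R) = F u + k%:~R.
      exact: lift_translate.
    (* Within one period this is [F01]; across periods, [F 1 = F 0 + 1] separates the values. *)
    have /andP[x1 x2] := floor_itv x; have /andP[y1 y2] := floor_itv y.
    rewrite -[x](subrK (Num.floor x)%:~R) -[y](subrK (Num.floor y)%:~R) !Fz.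
    have : Num.floor x <= Num.floor y by exact: le_floor.
    rewrite intrD in x2; rewrite intrD in y2.
    rewrite le_eqVlt => /orP[/eqP e|].
      by rewrite e in x1 x2 *; rewrite lerD2r; apply: F01 => //; lra.
    rewrite -lezD1 -(ler_int R) intrD => fxy.
    have h1 : F (x - (Num.floor x)%:~R) <= F 1 by apply: F01; lra.
    have h2 : F 0 <= F (y - (Num.floor y)%:~R) by apply: F01; lra.
    have := Fper 0; rewrite add0r; lra.
  + by move=> x; rewrite Fper; lra.
  + by move=> x /flat ->; lra.
  + by move=> x /left ->; lra.
  + by move=> x /right ->; lra.
- move=> x.
  have E n : iter n (fun x => F x - m%:~R) x = iter n F x - n%:R * m%:~R.
    elim: n => [|n IH]; first by rewrite mul0r subr0.
    rewrite !iterS IH -mulNr -natr1 [RHS]addrC.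
    have := lift_translate R F Fper (iter n F x) (- n%:Z * m).
    by rewrite intrM mulrNz -pmulrn => ->; ring.
  have : (fun n => iter n F x / n%:R - m%:~R) @ \oo --> rho0 - m%:~R.
    by apply: cvgB => //; exact: cvg_cst.
  apply: cvg_trans; apply: near_eq_cvg; exists 1%N => // n /= n0.
  by rewrite E mulrBl mulrAC mulfV ?mul1r // pnatr_eq0 -lt0n.
- move=> p q p0; rewrite mulrBr subr_eq.
  have -> : p%:R * m%:~R = (p%:Z * m)%:~R :> R by rewrite intrM -pmulrn.
  by rewrite -intrD rational_quotient.
Qed.

(** * Itinerary of the turning point and points shadowing it *)

Definition flip {R : realType} (s : bool) (x : R) : R := if s then 1 - x else x.

Lemma flip_dist {R : realType} (s : bool) (x y : R) :
  `|flip s x - flip s y| = `|x - y|.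
Proof. by case: s => //=; rewrite distrC; congr (`| _ |); ring. Qed.

Lemma len_le {R : realType} (J : set R) (d : R) : J !=set0 ->
  (forall x y, J x -> J y -> `|x - y| <= d) -> len J <= d.
Proof.
move=> J0 Jd; rewrite /len lerBlDr; apply: ge_sup => // x Jx.
rewrite -lerBlDl; apply: lb_le_inf => // y Jy.
by have := Jd x y Jx Jy; have := ler_norm (x - y); lra.
Qed.

Lemma intr_small (R : realType) (k : int) : -1 < (k%:~R : R) < 1 -> k = 0.
Proof.
have -> : (- 1 : R) = (- 1)%:~R by rewrite mulrNz.
by rewrite ltr_int ltrz1 => /andP[h1 h2]; lia.
Qed.

Section SturmianOrbit.
Variables (R : realType) (f G : R -> R) (a rho : R).
Local Notation c := (@turning R).
Local Notation C n := (mult_ceil R rho n).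
Local Notation X n := (iter n G c).
Hypothesis f_sym : {in `[0, 1], forall x : R, f (1 - x) = f x}.
Hypothesis f_top : f c = 1.
Hypothesis f1_lt : f 1 < c.
Hypotheses (a_ge0 : 0 <= a) (a_lt : a < c).
Hypothesis G_homo : {homo G : x y / x <= y}.
Hypothesis G_per : forall x, G (x + 1) = G x + 1.
Hypothesis G_flat : forall x, 0 <= x <= a -> G x = 1 - f 1.
Hypothesis G_left : forall x, a <= x <= c -> G x = f x.
Hypothesis G_right : forall x, c <= x <= 1 -> G x = 2 - f x.
Hypothesis G_rot : forall x, (fun n => iter n G x / n%:R) @ \oo --> rho.
Hypothesis rho_irr : forall (p : nat) (q : int),
  (0 < p)%N -> p%:R * rho != q%:~R.

Let facts : [/\ 2 * c = 1, f 1 < c, 0 <= a & a < c].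
Proof. by split=> //; exact: turningE. Qed.

Let order (m n : nat) (k : int) :
  (X n < X m + k%:~R) = (n%:R * rho < m%:R * rho + k%:~R).
Proof. exact: orbit_order. Qed.

Let order' (m n : nat) (k : int) :
  (X m + k%:~R < X n) = (m%:R * rho + k%:~R < n%:R * rho).
Proof. by rewrite -ltrBrDr -mulrNz order mulrNz ltrBrDr. Qed.

Let translate (n : nat) (x : R) (k : int) :
  iter n G (x + k%:~R) = iter n G x + k%:~R.
Proof. exact: iter_translate. Qed.

Lemma orbit1 : X 1 = 1.
Proof. by rewrite /= G_left ?f_top // ltW //= lexx. Qed.

Lemma orbit2 : X 2 = 2 - f 1.
Proof.
by rewrite iterS orbit1 G_right // lexx andbT; have [? _ _ _] := facts; lra.
Qed.

(** The orbit order translates [c < X 2 - 1 = 1 - f 1]. *)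
Lemma rotation_gt : 1 < 2 * rho.
Proof.
have [? ? ? ?] := facts.
have : X 0 < X 2 + (- 1%:Z)%:~R by rewrite orbit2 /= mulrNz; lra.
by rewrite order mul0r mulrNz; lra.
Qed.

Lemma rotation_lt : rho < 1.
Proof.
have [? ? ? ?] := facts.
have : X 1 < X 0 + 1%:~R by rewrite orbit1 /=; lra.
by rewrite order mul0r mul1r add0r.
Qed.

(* The orbit of [y] is sandwiched between that of [c] and the points of the
   orbit of [c] on its left, so it has the same itinerary as that of [c]. *)
Definition shadowing (y : R) : Prop := a <= y <= c /\
  forall (m n : nat) (k : int), m%:R * rho + k%:~R < n%:R * rho ->
    X m + k%:~R < iter n G y.

Lemma shadowing_turning : shadowing c.
Proof. by split=> [|m n k]; [rewrite lexx ltW | rewrite order']. Qed.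

Lemma shadowing_ge (y z : R) : shadowing y -> y <= z <= c -> shadowing z.
Proof.
move=> [/andP[ay _] sy] /andP[yz zc]; split; first by rewrite (le_trans ay).
by move=> m n k /sy /lt_le_trans; apply; exact: iter_homo.
Qed.

(** Subtracting [C n] brings the point to the part of the unit interval where [G] is given by [f];
    its bounds and its side of [c] follow from comparison with translates of [X 1], [X 2] and
    [X 0]. *)
Lemma shadowing_iter (y : R) (n : nat)
    (w := iter n.+1 G y - (C n)%:~R) : shadowing y ->
  a < w <= 1 /\ (c < w) = itinerary R rho n.+1.
Proof.
have [? ? ? ?] := facts.
move=> [/andP[ay yc] sy].
have le_yX : iter n.+1 G y <= X n.+1 by exact: iter_homo.
have w1 : w <= 1.
  suff : ~~ (X 1 + (C n)%:~R < X n.+1) by rewrite orbit1 -leNgt /w; lra.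
  rewrite order' mul1r -natr1 mulrDl mul1r -leNgt.
  by have := ceil_ge (n%:R * rho); rewrite /mult_ceil; lra.
have lt_C : (C n)%:~R - 1 < n%:R * rho.
  by have := ceilB1_lt (n%:R * rho); rewrite intrD mulrNz.
have w0 : a < w.
  rewrite ltNge; apply/negP => wa.
  have w_ge0 : 0 <= w.
    have := sy 1%N n.+1 (C n - 1); rewrite orbit1 intrD mulrNz mul1r -natr1.
    by move=> H; have := H ltac:(lra); rewrite /w; lra.
  (* From the flat part, the next iterate would be a translate of [X 2] that shadowing puts strictly
     below it. *)
  have : iter n.+2 G y = 1 - f 1 + (C n)%:~R.
    rewrite -(G_flat w) ?w_ge0 // -(lift_translate R G G_per).
    by rewrite /w subrK.
  have := sy 2%N n.+2 (C n - 1).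
  rewrite orbit2 intrD mulrNz -(natr1 n.+1) -(natr1 n).
  by move=> /[swap] -> H; have := H ltac:(lra); lra.
split; first by rewrite w0.
apply/idP/idP => [cw|].
  rewrite /= /mult_ceil ceil_gt_int -/(C n).
  have := order' 0 n.+1 (C n); rewrite mul0r add0r => <- /=.
  by rewrite -/(X n.+1); move: cw le_yX; rewrite /w; lra.
rewrite /= /mult_ceil ceil_gt_int -/(C n) => h.
have := sy 0%N n.+1 (C n); rewrite mul0r add0r => /(_ h).
by rewrite /w /=; lra.
Qed.

(** By symmetry [f] forgets the previous flip. On the right of [c], [G] is [2 - f] and [C] grows by
    [1], which amounts to a new flip. *)
Lemma iter_flip (y : R) (n : nat) : shadowing y ->
  iter n.+1 f y = flip (itinerary R rho n) (iter n.+1 G y - (C n)%:~R).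
Proof.
have [? ? ? ?] := facts.
move=> sy; elim: n => [|n IH].
  by rewrite /= mult_ceil0 subr0 G_left //; case: sy.
have [/andP[w0 w1] cw] := shadowing_iter y n sy.
rewrite [LHS]iterS IH; set w := _ - _ in w0 w1 cw *.
have w01 : w \in `[0, 1] by rewrite in_itv /=; apply/andP; split; lra.
have -> : f (flip (itinerary R rho n) w) = f w.
  by case: itinerary => //=; rewrite f_sym.
have -> : iter n.+2 G y = G w + (C n)%:~R.
  by rewrite -(lift_translate R G G_per) subrK.
have /andP[C1 C2] := mult_ceilS R rho rotation_gt rotation_lt n.
case e : (itinerary R rho n.+1) in cw *.
  rewrite G_right; last by rewrite ltW.
  have -> : C n.+1 = C n + 1 by move: e; rewrite /=; lia.
  by rewrite intrD /flip; ring.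
rewrite G_left; last by rewrite ltW //= leNgt cw.
have -> : C n.+1 = C n by move: e; rewrite /=; lia.
by rewrite /flip; ring.
Qed.

Lemma kneading_itinerary (n : nat) :
  kneading f n.+1 = itinerary R rho n.+1 (+) itinerary R rho n.
Proof.
have [? ? ? ?] := facts.
rewrite /kneading /crit iter_flip; last exact: shadowing_turning.
have [_ <-] := shadowing_iter c n shadowing_turning.
(* Equality would make [(n + 1) rho] the integer [C n], by the orbit order. *)
set w := _ - _; have : w != c.
  rewrite /w subr_eq; apply/eqP => e.
  have := order 0 n.+1 (C n); have := order' 0 n.+1 (C n).
  rewrite e /= !ltxx mul0r add0r => /esym h1 /esym h2.
  by have := rho_irr n.+1 (C n) isT; rewrite neq_lt h1 h2.
by case: itinerary; rewrite /flip /= ?addbF ?addbT => h; apply/idP/idP;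
   rewrite -?leNgt; move: h; rewrite neq_lt => /orP[]; lra.
Qed.

(** Between [X m + k] and [X n] there is another translated orbit point, of index at least [n]. Were
    it above [G ^ n y], its pullback by [G ^ n] would lie in the gap. *)
Lemma shadowing_of_gap (y : R) : a <= y < c ->
  ~ (exists (n : nat) (k : int), y < X n + k%:~R < c) -> shadowing y.
Proof.
move=> /andP[ay yc] none; split=> [|m n k mn]; first by rewrite ay ltW.
have d0 : 0 < (n%:R * rho - m%:R * rho - k%:~R) / n.+1%:R.
  by rewrite divr_gt0 ?ltr0n //; lra.
have [p [q [p0 /andP[pq0 pqd]]]] := dirichlet R rho rho_irr _ d0.
rewrite ltr_pdivlMr ?ltr0n // in pqd.
(* The [n.+1] small rotation steps stay below [n rho] and make [m'] at least [n]. *)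
pose m' := (m + n.+1 * p)%N; pose k' := k - n.+1%:Z * q.
have E : m'%:R * rho + k'%:~R =
    m%:R * rho + k%:~R + n.+1%:R * (p%:R * rho - q%:~R).
  by rewrite natrD natrM intrD mulrNz intrM -pmulrn; ring.
have h1 : X m + k%:~R < X m' + k'%:~R.
  rewrite -ltrBrDr -addrA -mulrNz -intrD order intrD mulrNz addrA E.
  by have := mulr_gt0 (ltr0Sn R n) pq0; lra.
have h2 : X m' + k'%:~R < X n by rewrite order' E; lra.
apply: (lt_le_trans h1); rewrite leNgt; apply/negP => h3; apply: none.
have nm' : (n <= m')%N.
  by apply: leq_trans (leq_addl _ _); exact: leq_trans (leq_pmulr _ p0).
exists (m' - n)%N, k'; move: h2 h3.
have -> : X m' = iter n G (X (m' - n)) by rewrite -iterD subnKC.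
rewrite -(translate n).
by move=> /(iter_lt_inv _ _ G_homo) -> /(iter_lt_inv _ _ G_homo) ->.
Qed.

(* [f ^ n] maps [[y, c]] monotonically onto an interval with the same length
   as [[G ^ n y, X n]]. *)
Lemma shadowing_length (y : R) : contraction_principle f -> shadowing y ->
  y < c -> exists2 d : R, 0 < d &
    forall n, (0 < n)%N -> iter n G y + d <= X n.
Proof.
have [? ? ? ?] := facts.
move=> contr sy yc; have /andP[ay _] := sy.1.
have [d d0 dP] := contr ((c - y) / 2) ltac:(lra).
exists d => // -[//|n] _.
have ycl : len `[y, c] = c - y by rewrite /len sup_itvcc ?inf_itvcc ?ltW.
have dl : d < len (iter n.+1 f @` `[y, c]).
  apply: dP; rewrite ?ycl //; [exact: interval_is_interval| |by lra].
  by move=> z /=; rewrite !in_itv /= => /andP[? ?]; apply/andP; split; lra.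
have : len (iter n.+1 f @` `[y, c]) <= X n.+1 - iter n.+1 G y.
  apply: len_le.
    by exists (iter n.+1 f c), c; rewrite //= in_itv /= lexx ltW.
  have itvP u : `[y, c]%classic u -> y <= u <= c by rewrite /= in_itv.
  move=> _ _ [u /itvP uin <-] [v /itvP vin <-].
  rewrite !iter_flip; [|exact: shadowing_ge vin|exact: shadowing_ge uin].
  rewrite flip_dist.
  have /andP[u1 u2] := uin; have /andP[v1 v2] := vin.
  have Gn := iter_homo R G G_homo n.+1.
  have := Gn _ _ u1; have := Gn _ _ u2; have := Gn _ _ v1; have := Gn _ _ v2.
  by move=> *; rewrite ler_norml; apply/andP; split; lra.
lra.
Qed.

(* The intervals [[G ^ n y, X n]] are disjoint modulo [1], so their lengths
   cannot be bounded below. *)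
Lemma shadowing_eq (y : R) : contraction_principle f -> shadowing y -> y = c.
Proof.
have [? ? ? ?] := facts.
move=> contr sy; apply/eqP; case: (ltgtP y c) => // [yc|]; last first.
  by have := sy.1; lra.
have [d d0 gap] := shadowing_length y contr sy yc.
have step m n k : (0 < n)%N -> m%:R * rho + k%:~R < n%:R * rho ->
    X m + k%:~R + d < X n.
  by move=> n0 mn; have := gap n n0; have [_ /(_ m n k mn)] := sy; lra.
have [N /andP[_ Nd]] := euclid_nat 1 d ler01 d0.
have [p [q [p0 /andP[pq0 pqd]]]] : exists p (q : int), (0 < p)%N /\
    0 < p%:R * rho - q%:~R < N.+1%:R^-1.
  by apply: dirichlet => //; rewrite invr_gt0 ltr0n.
(* Each block of [p] iterates gains at least [d] over [q]; yet [N.+1] blocks gain less than [1],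
   since they rotate by less than [1]. *)
have grow i : 1 + i%:R * d <= X (1 + i * p) - i%:R * q%:~R.
  elim: i => [|i IH]; first by rewrite !mul0r subr0 addr0 orbit1.
  have := step (1 + i * p)%N (1 + i.+1 * p)%N q isT.
  rewrite mulSn !natrD natrM -natr1 => h.
  suff : X (1 + i * p) + q%:~R + d < X (1 + (p + i * p)) by lra.
  by apply: h; lra.
have : X (1 + N.+1 * p) < X 1 + (1 + N.+1%:Z * q)%:~R.
  rewrite order natrD natrM intrD intrM -pmulrn.
  have := pqd; rewrite -[_^-1]mul1r ltr_pdivlMr ?ltr0n //; lra.
have := grow N.+1; rewrite orbit1 intrD intrM -pmulrn; lra.
Qed.

(** * Recurrence of the turning point *)

Lemma orbit_left_near (y : R) :
  contraction_principle f -> a <= y < c ->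
  exists (n : nat) (k : int), y < X n + k%:~R < c.
Proof.
move=> contr /[dup] ayc /andP[_ yc]; apply: contrapT => none.
by rewrite (shadowing_eq y contr (shadowing_of_gap y ayc none)) ltxx in yc.
Qed.

Lemma turning_recurrent : contraction_principle f -> uniformly_recurrent f c.
Proof.
have [? ? ? ?] := facts.
move=> contr U Uo Uc.
have /nbhs_ballP[e /= e0 eU] : nbhs c U by exact: open_nbhs_nbhs.
pose y := Num.max a (c - e).
have [n [k /andP[yX Xc]]] : exists (n : nat) (k : int), y < X n + k%:~R < c.
  by apply: orbit_left_near; rewrite // /y le_max lexx /= gt_max a_lt; lra.
have := order' n 0 k; rewrite /= Xc mul0r => /esym nk.
have nk0 : 0 < - (n%:R * rho + k%:~R) by lra.
have [p [q [p0 /andP[pq0 pqd]]]] := dirichlet R rho rho_irr _ nk0.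
(* More than [I] steps of size [p rho - q] exceed [1], hence any defect; this bounds the return
   time. *)
have [I /andP[_ I1]] := euclid_nat 1 _ ler01 pq0.
exists (1 + I * p)%N => j _.
have /andP[d0 d1] := defect_itv R rho rho_irr j.+1 isT.
(* After [i] steps, less than one step of the defect remains: [l rho + m] is negative but above
   [n rho + k], so [X l + m] lies between [y] and [c]. *)
have [i /andP[i1 i2]] := euclid_nat _ _ (ltW d0) pq0.
exists (1 + i * p)%N.
  rewrite /= leq_add2l leq_mul2r; apply/orP; right.
  rewrite -ltnS -(ltr_nat R) -(ltr_pM2r pq0).
  by apply: le_lt_trans i1 _; exact: lt_trans I1.
set l := (j + _)%N; pose m := - (C j.+1 + i%:Z * q).
have E : l%:R * rho + m%:~R = i%:R * (p%:R * rho - q%:~R) - defect R rho j.+1.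
  rewrite /l /m /defect mulrNz intrD intrM -pmulrn addnA addn1 natrD natrM.
  ring.
have neq : l%:R * rho + m%:~R != 0.
  rewrite addrC -[m%:~R]opprK addrC subr_eq0 -mulrNz rho_irr //.
  by rewrite /l addnA addn1.
have Xl : X l + m%:~R < c.
  have := order' l 0 m; rewrite /= mul0r => ->; rewrite lt_neqAle neq E; lra.
have Xl' : y < X l + m%:~R.
  apply: (lt_trans yX).
  rewrite -ltrBrDr -addrA -mulrNz -intrD order intrD mulrNz.
  rewrite addrA E; move: i2; rewrite -natr1; lra.
pose l0 := (j + i * p)%N; have lE : l = l0.+1 by rewrite /l addnCA.
rewrite lE in Xl Xl' *.
have [/andP[w0 w1] _] := shadowing_iter c l0 shadowing_turning.
have ay : a <= y by rewrite /y le_max lexx.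
have ey : c - e <= y by rewrite /y le_max lexx orbT.
(* Both integers bring [X l] into the unit interval, to points less than [1] apart. *)
have mE : C l0 = - m.
  apply/eqP; rewrite -addr_eq0; apply/eqP/(intr_small R); rewrite intrD.
  by apply/andP; split; lra.
apply: eU; rewrite /ball /= -/(iter l0.+1 f c) iter_flip; last first.
  exact: shadowing_turning.
have := flip_dist (itinerary R rho l0) c (X l0.+1 - (C l0)%:~R).
have -> : flip (itinerary R rho l0) c = c.
  by case: itinerary => //; rewrite /flip; lra.
by move=> ->; rewrite mE mulrNz opprK gtr0_norm; lra.
Qed.

End SturmianOrbit.

Theorem proposition6p7 (R : realType) (f : R -> R) (a : R)
    (hf : standing_assumptions f)
    (ha : 0 <= a < turning) (hphia : phi f a = phi f 1)
    (hsturm : irrational_rotation (phi_bar f a)) :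
  (cokneading (kneading f) @ \oo --> \oo) /\ uniformly_recurrent f turning.
Proof.
have [unim c2_lt _ _ _ _ contr] := hf.
have [_ _ _ _ f_sym f_top] := unim.
have f1_lt : f 1 < turning by move: c2_lt; rewrite /crit /= f_top.
have [a_ge0 a_lt] := andP ha.
have [G [rho [[G_homo G_per G_flat G_left G_right] G_rot rho_irr]]] :=
  exists_normalized_lift R f a unim ha hphia hsturm.
split; last exact: (turning_recurrent R f G a rho).
apply: (cokneading_cvg R rho rho_irr).
- exact: (rotation_gt R f G a rho).
- exact: (rotation_lt R f G a rho).
- exact: (kneading_itinerary R f G a rho).
Qed.
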